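(* Let $S$ be a Polish space and let $c:S\times S\to[0,\infty)$ satisfy (a) $c(x,x)=0$ for all $x\in S$; (b) $c(x,z)\le c(x,y)+c(y,z)$ for all $x,y,z\in S$; (c) there exist lower semicontinuous functions $c_n:S\times S\to[0,\infty)$, $n\in\mathbb N$, with $c_n\downarrow c$ pointwise as $n\to\infty$ (i.e. $c_n$ non-increasing in $n$ and converging pointwise to $c$). Then for all Borel probability measures $\mu,\nu$ on $S$, \[ \sup\Big\{\int_S\phi\,d\mu+\int_S\psi\,d\nu:\ \phi,\psi\in b\mathcal B(S),\ \phi(x)+\psi(y)\le c(x,y)\ \forall x,y\in S\Big\} =\sup\Big\{\int_S\phi\,d\mu-\int_S\phi\,d\nu:\ \phi\in b\mathcal B(S),\ \phi(x)-\phi(y)\le c(x,y)\ \forall x,y\in S\Big\}. \]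
   Context: $b\mathcal{B}(S)$ denotes the set of all bounded Borel measurable functions $S\to\mathbb{R}$. *)

(* Defs.v *)
From HB Require Import structures.
From mathcomp Require Import all_boot all_order all_algebra.
From mathcomp Require Import all_classical all_reals all_analysis.
Set Implicit Arguments. Unset Strict Implicit. Unset Printing Implicit Defensive.
Import Order.TTheory GRing.Theory Num.Theory numFieldNormedType.Exports.
Local Open Scope classical_set_scope.
Local Open Scope ring_scope.

(* Polish space: we take S with a given complete (pseudo)metric inducing its
   topology, require it to be Hausdorff (so the pseudometric is a metric) and
   separable (a countable dense subset). *)
Definition separable_space (T : topologicalType) : Prop :=
  exists D : set T, countable D /\ dense D.

Definition polish_space (R : realType) (S : completePseudoMetricType R) : Prop :=
  hausdorff_space S /\ separable_space S.

Definition borel (T : ptopologicalType) := g_sigma_algebraType (@open T).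

Definition bB (R : realType) (T : ptopologicalType) (f : T -> R) : Prop :=
  measurable_fun [set: borel T] (f : borel T -> R) /\
  exists M : R, forall x, `|f x| <= M.

(* Main.v *)
Require Import Defs.
From HB Require Import structures.
From mathcomp Require Import all_boot all_order all_algebra.
From mathcomp Require Import all_classical all_reals all_analysis.
From mathcomp Require Import measurable_realfun.
Import Order.TTheory GRing.Theory Num.Theory numFieldNormedType.Exports.
Local Open Scope classical_set_scope.
Local Open Scope ring_scope.

(** Given an admissible pair [(phi, psi)], the natural [c]-Lipschitz potential
    [x |-> inf_y (c x y - psi y)] lies between [phi] and [- psi], but it is in
    general only universally measurable. Taking the infimum over a
    sigma-compact set of full [nu]-measure restores Borel measurability: for
    rational [q], inner regularity of [nu] provides compact sets [K q j] that
    exhaust [{psi >= q}] up to a [nu]-null set, and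

      h x = min (M, inf {c x y - q | y in K q j}),   M a bound of [|psi|],

    is Borel because [{x | exists y in K, c x y < t}] is a countable union of
    projections of closed sets [{c_n <= t - 1/(k+1)}] along the compact [K].
    The function [h] is still [c]-Lipschitz everywhere, [phi <= h] everywhere,
    and [h <= - psi] holds [nu]-almost everywhere since [c x x = 0]. *)

(** * Projections along compact sets, and compactness from total boundedness *)

(** Tube lemma: for [x] outside the projection, each [(x, y)] with [y] in [K] has a product
    neighbourhood missing [C], and compactness of [K] yields one neighbourhood of [x] serving all
    [y]. *)
Lemma closed_compact_projection (S T : topologicalType) (K : set T)
    (C : set (S * T)) :
  compact K -> closed C -> closed [set x | exists2 y, K y & C (x, y)].
Proof.
move=> /compact_near_coveringP cK clC; rewrite -openC openE => x /= nx.
have := cK S (nbhs x) (fun x' y => ~ C (x', y)) _.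
move=> H; have : \forall x' \near x, K `<=` (fun y => ~ C (x', y)).
  apply: H => y Ky.
  have oC : open (~` C) by rewrite openC.
  have Cxy : (~` C) (x, y) by move=> Cxy; apply: nx; exists y.
  have [[/= U V] [Ux Vy] UV] := open_nbhs_nbhs (conj oC Cxy).
  by exists (V, U) => // -[y' x'] [/= Vy' Ux']; exact: (UV (x', y')).
by apply: filterS => x' Kx' [y Ky]; exact: Kx'.
Qed.

Lemma ultra_bigsetU (T : Type) (F : set_system T) (A : nat -> set T) n :
  UltraFilter F -> F (\big[setU/set0]_(i < n) A i) -> exists i, F (A i).
Proof.
move=> FU; elim: n => [|n IH].
  by rewrite big_ord0 => /filter_ex[].
rewrite big_ord_recr /= => FA.
have [|FnA] := in_ultra_setVsetC (A n) FU; first by exists n.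
apply: IH; apply: filterS (filterI FA FnA) => x [[]] //.
Qed.

Lemma closure_ball_sub (R : realFieldType) (T : pseudoMetricType R) (x : T)
    (e : R) :
  0 < e -> closure (ball x e) `<=` ball x (e + e).
Proof.
move=> e0 y /(_ _ (nbhsx_ballx y _ e0)) [z [xz yz]].
exact: ball_triangle xz (ball_sym yz).
Qed.

(** An ultrafilter containing this set contains, for each [k], one of the finitely many closed
    pieces, so it is Cauchy. Completeness gives a limit, and closedness keeps it in the set. *)
Lemma compact_bigcap_closed_ball (R : realType) (S : completePseudoMetricType R)
    (d : nat -> S) (N : nat -> nat) :
  compact (\bigcap_k \big[setU/set0]_(i < N k)
    closure (ball (d i) k.+1%:R^-1)).
Proof.
set K := \bigcap_k _.
have clK : closed K.
  by apply: closed_bigI => k _; apply: closed_bigsetU => i _; exact: closed_closure.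
rewrite compact_ultra => F FU FK.
have /cauchy_exP Fc : cauchy_ex F.
  (* Half of [e], since the closure of a ball is only placed in the ball of twice its radius. *)
  move=> e e0; have [k ke] : exists k : nat, k.+1%:R^-1 < e / 2.
    have := @near_infty_natSinv_lt R (PosNum (divr_gt0 e0 (ltr0n _ 2))).
    by move=> [k _ /(_ k (leqnn k))]; exists k.
  have /(@ultra_bigsetU _ _ (fun i => closure (ball (d i) k.+1%:R^-1)) _ FU) [i Fi] :
      F (\big[setU/set0]_(i < N k) closure (ball (d i) k.+1%:R^-1)).
    by apply: filterS FK; exact: bigcap_inf.
  exists (d i); apply: filterS Fi => y /closure_ball_sub => /(_ _).
  move/(_ (ltac:(by rewrite invr_gt0))); apply: le_ball.
  by rewrite [leRHS](splitr e); apply: lerD; exact: ltW.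
have Fl : F --> lim F by exact: cauchy_cvg.
exists (lim F); split => //; rewrite (closure_id K).1 // => B Bl.
have [z] := @filter_ex _ F _ _ (filterI FK (Fl _ Bl)).
by exists z.
Qed.

(** * Borel sets and continuity of finite measures *)

Lemma measurable_open (T : ptopologicalType) (A : set T) :
  open A -> measurable (A : set (borel T)).
Proof. by move=> oA; exact: sub_sigma_algebra. Qed.

Lemma measurable_closed (T : ptopologicalType) (A : set T) :
  closed A -> measurable (A : set (borel T)).
Proof.
move=> cA; rewrite -[A]setCK; apply: measurableC; apply: measurable_open.
by rewrite openC.
Qed.

Lemma finite_measure_bigcap_lt (d : measure_display) (T : measurableType d)
    (R : realType) (mu : {finite_measure set T -> \bar R}) (B : nat -> set T) (e : \bar R) :
  (forall n, measurable (B n)) -> nonincreasing_seq B ->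
  (mu (\bigcap_n B n) < e)%E -> exists n, (mu (B n) < e)%E.
Proof.
move=> mB niB lte.
have [n _ Hn] : \forall n \near \oo, (mu (B n) < e)%E.
  have mcap : measurable (\bigcap_n B n) by exact: bigcapT_measurable.
  have fin : (mu (B 0%N) < +oo)%E by rewrite ltey_eq fin_num_measure.
  apply: (nonincreasing_cvg_mu fin mB mcap niB (t := [set y | (y < e)%E])).
  exact: (open_nbhs_nbhs (conj (@open_ereal_lt_ereal _ e) lte)).
by exists n; exact: Hn (leqnn n).
Qed.

(** Continuity from above along the decreasing remainders. It replaces a countable union by a finite
    one, which preserves compactness. *)
Lemma finite_measure_setD_bigcup_lt (d : measure_display) (T : measurableType d)
    (R : realType) (mu : {finite_measure set T -> \bar R}) (A : set T)
    (F : nat -> set T) (e : \bar R) :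
  measurable A -> (forall n, measurable (F n)) ->
  (mu (A `\` \bigcup_n F n) < e)%E ->
  exists n, (mu (A `\` \big[setU/set0]_(i < n) F i) < e)%E.
Proof.
move=> mA mF lte.
apply: (@finite_measure_bigcap_lt _ _ _ mu
  (fun n => A `\` \big[setU/set0]_(i < n) F i)).
- by move=> n; apply: measurableD => //; exact: bigsetU_measurable.
- move=> m n mn; apply/subsetPset; apply: setDS.
  exact: (@subset_bigsetU _ F _ _ mn).
- apply: le_lt_trans lte; apply: le_measure; rewrite ?inE.
  + apply: bigcapT_measurable => n; apply: measurableD => //.
    exact: bigsetU_measurable.
  + by apply: measurableD => //; exact: bigcupT_measurable.
  + move=> x xA; split; first by have [] := xA 0%N I.
    (* Index [n.+1], because the union over [i < n] stops before [F n]. *)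
    move=> [n _ Fnx]; have [_] := xA n.+1 I; apply.
    by rewrite big_ord_recr; right.
Qed.

(** The bounds sum to [e / 2], which leaves room for a strict inequality after the limit. *)
Lemma lte_nneseries_geometric (R : realType) (e : R) (u : nat -> \bar R) :
  0 < e ->
  (forall n, (0 <= u n)%E) ->
  (forall n, (u n < (e / 2 / (2 ^ n.+1)%:R)%:E)%E) ->
  (\sum_(0 <= n <oo) u n < e%:E)%E.
Proof.
move=> e0 u0 ult; apply: (@le_lt_trans _ _ (e / 2)%:E); last first.
  by rewrite lte_fin ltr_pdivrMr // ltr_pMr // ltr1n.
have e20 : 0 <= e / 2 by rewrite divr_ge0 // ltW.
apply: le_trans (epsilon_trick0 xpredT e20).
by apply: lee_nneseries => // n *; exact: ltW (ult n).
Qed.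

(** * Inner regularity of finite Borel measures on Polish spaces *)

Section compact_inner_regularity.
Context (R : realType) (S : completePseudoMetricType R).
Context (nu : {finite_measure set (borel S) -> \bar R}).
Hypothesis polS : polish_space S.

(** Phrased by the measure of the leftover rather than by a supremum, so that countable operations
    reduce to subadditivity. *)
Definition compact_inner_regular (A : set S) := forall e : R, 0 < e ->
  exists K : set S, [/\ compact K, K `<=` A & (nu (A `\` K) < e%:E)%E].

Let measurable_compact (K : set S) : compact K -> measurable (K : set (borel S)).
Proof. by move=> cK; apply: measurable_closed; apply: compact_closed cK; case: polS. Qed.

(** Ulam's theorem: at each radius [r k], finitely many balls centred in the dense set miss mass
    less than [e / 2 ^ (k + 2)]; the intersection of these finite unions is closed and totally
    bounded. *)
Lemma polish_tight : compact_inner_regular setT.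
Proof.
case: polS => _ [D [Dcount Ddense]] e e0.
have D0 : D !=set0 by have [x []] := Ddense setT (ltac:(by exists point)) openT; exists x.
move: Dcount => /pfcard_geP [DE|[f]]; first by move: D0; rewrite DE => -[].
pose r (k : nat) : R := k.+1%:R^-1.
have r0 k : 0 < r k by rewrite invr_gt0.
have mB k i : measurable (closure (ball (f i) (r k)) : set (borel S)).
  by apply: measurable_closed; exact: closed_closure.
have cover k : \bigcup_i closure (ball (f i) (r k)) = setT.
  apply/seteqP; split => // x _.
  have [|y [yx Dy]] := Ddense (ball x (r k))^° _ (open_interior _).
    by exists x; exact: nbhsx_ballx.
  have [i _ fiy] := @surj _ _ _ _ f y Dy.
  exists i => //; apply: subset_closure; rewrite fiy; apply: ball_sym.
  exact: interior_subset.
have /choice[N HN] : forall k, exists N,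
    (nu (setT `\` \big[setU/set0]_(i < N) closure (ball (f i) (r k))) <
      (e / 2 / (2 ^ k.+1)%:R)%:E)%E.
  move=> k; apply: (@finite_measure_setD_bigcup_lt _ _ _ nu setT
    (fun i => closure (ball (f i) (r k)))) => //.
  by rewrite cover setDv measure0 lte_fin !divr_gt0 // ltr0n expn_gt0.
exists (\bigcap_k \big[setU/set0]_(i < N k) closure (ball (f i) (r k))).
split => //; first exact: compact_bigcap_closed_ball.
have mU k : measurable
    (\big[setU/set0]_(i < N k) closure (ball (f i) (r k)) : set (borel S)).
  exact: bigsetU_measurable.
have nu0 k : (0 <= nu (setT `\` \big[setU/set0]_(i < N k)
    closure (ball (f i) (r k))))%E by exact: measure_ge0.
apply: le_lt_trans (lte_nneseries_geometric _ _ _ e0 nu0 HN).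
apply: measure_sigma_subadditive => //.
- by move=> k; exact: measurableD.
- by apply: measurableD => //; exact: bigcapT_measurable.
- by rewrite setTD setC_bigcap => x [k _ xk]; exists k => //; rewrite setTD.
Qed.

Lemma closed_compact_inner_regular (C : set S) : closed C -> compact_inner_regular C.
Proof.
move=> cC e /polish_tight[K [cK _ nuK]]; exists (C `&` K).
have cCK : compact (C `&` K) by rewrite setIC; apply: compact_closedI.
split => //; apply: le_lt_trans nuK; apply: le_measure; rewrite ?inE.
- by apply: measurableD; [exact: measurable_closed|exact: measurable_compact].
- by apply: measurableD; [|exact: measurable_compact].
- by move=> x [Cx CKx]; split => // Kx; exact: CKx.
Qed.

(** The union of the approximating compacts [K n] has small leftover but need not be compact, so it
    is cut at a finite stage [N]. *)
Lemma bigcup_compact_inner_regular (A : nat -> set S) :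
  (forall n, measurable (A n : set (borel S))) ->
  (forall n, compact_inner_regular (A n)) ->
  compact_inner_regular (\bigcup_n A n).
Proof.
move=> mA rA e e0.
have /choice[K HK] : forall n, exists K, [/\ compact K, K `<=` A n &
    (nu (A n `\` K) < (e / 2 / (2 ^ n.+1)%:R)%:E)%E].
  by move=> n; apply: rA; rewrite !divr_gt0 // ltr0n expn_gt0.
have mK n : measurable (K n : set (borel S)).
  by have [cK _ _] := HK n; exact: measurable_compact.
have mAU : measurable (\bigcup_n A n : set (borel S)) by exact: bigcupT_measurable.
have [N nuN] : exists N,
    (nu (\bigcup_n A n `\` \big[setU/set0]_(i < N) K i) < e%:E)%E.
  apply: (@finite_measure_setD_bigcup_lt _ _ _ nu (\bigcup_n A n) K) => //.
  have nu0 n : (0 <= nu (A n `\` K n))%E by exact: measure_ge0.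
  have nuK n : (nu (A n `\` K n) < (e / 2 / (2 ^ n.+1)%:R)%:E)%E by case: (HK n).
  apply: le_lt_trans (lte_nneseries_geometric _ _ _ e0 nu0 nuK).
  apply: measure_sigma_subadditive.
  - by move=> n; exact: measurableD.
  - by apply: measurableD => //; exact: bigcupT_measurable.
  - by move=> x [[n _ Anx] nKx]; exists n => //; split => // Knx; apply: nKx; exists n.
exists (\big[setU/set0]_(i < N) K i); split => //.
- by apply: bigsetU_compact => i _; case: (HK i).
- move=> x /(@bigsetU_bigcup _ K N)[n _ Knx]; exists n => //.
  by have [_ + _] := HK n; exact.
Qed.

Lemma bigcap_compact_inner_regular (A : nat -> set S) :
  (forall n, measurable (A n : set (borel S))) ->
  (forall n, compact_inner_regular (A n)) ->
  compact_inner_regular (\bigcap_n A n).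
Proof.
move=> mA rA e e0.
have /choice[K HK] : forall n, exists K, [/\ compact K, K `<=` A n &
    (nu (A n `\` K) < (e / 2 / (2 ^ n.+1)%:R)%:E)%E].
  by move=> n; apply: rA; rewrite !divr_gt0 // ltr0n expn_gt0.
have mK n : measurable (K n : set (borel S)).
  by have [cK _ _] := HK n; exact: measurable_compact.
exists (\bigcap_n K n); split.
(* The intersection is closed and lies in the compact [K 0]. *)
- apply: (@subclosed_compact _ _ (K 0%N)); last exact: bigcap_inf.
    apply: closed_bigI => n _; have [cK _ _] := HK n.
    by apply: compact_closed cK; case: polS.
  by case: (HK 0%N).
- by move=> x Kx n _; have [_ + _] := HK n; apply; exact: Kx.
- have nu0 n : (0 <= nu (A n `\` K n))%E by exact: measure_ge0.
  have nuK n : (nu (A n `\` K n) < (e / 2 / (2 ^ n.+1)%:R)%:E)%E by case: (HK n).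
  apply: le_lt_trans (lte_nneseries_geometric _ _ _ e0 nu0 nuK).
  apply: measure_sigma_subadditive.
  - by move=> n; exact: measurableD.
  - by apply: measurableD; exact: bigcapT_measurable.
  - rewrite setDE setC_bigcap => x [Ax [n _ nKx]]; exists n => //; split => //.
    exact: Ax.
Qed.

Lemma open_bigcup_closed (U : set S) : open U ->
  exists2 C : nat -> set S, (forall k, closed (C k)) & U = \bigcup_k C k.
Proof.
(* [C k] keeps the points that stay about [1 / (k + 1)] away from the complement of [U]; interiors
   are taken because these balls need not be open. *)
move=> oU; pose C k := ~` \bigcup_(x in ~` U) (ball x (k.+1%:R^-1 : R))^°.
exists C => [k|].
  by rewrite -openC setCK; apply: bigcup_open => x _; exact: open_interior.
apply/seteqP; split => [y Uy|y [k _ Cy]]; last first.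
  by apply: contrapT => nUy; apply: Cy; exists y => //; exact: nbhsx_ballx.
have /nbhs_ballP[e /= e0 eU] : nbhs y U by exact: open_nbhs_nbhs.
have [k _ /(_ k (leqnn k)) ke] := near_infty_natSinv_lt (PosNum e0).
exists k => // -[x nUx /interior_subset xy]; apply: nUx; apply: eU.
by apply: ball_sym; apply: le_ball xy; exact: ltW.
Qed.

(** Good sets principle: asking regularity of both a set and its complement gives a class closed
    under complement, and the union and intersection lemmas make it a sigma-algebra containing the
    open sets. *)
Lemma borel_compact_inner_regular (A : set S) :
  measurable (A : set (borel S)) -> compact_inner_regular A.
Proof.
suff : measurable `<=` [set A : set (borel S) | [/\ measurable A,
    compact_inner_regular A & compact_inner_regular (~` A)]].
  by move=> H /H[].
apply: smallest_sub => [|U oU]; last first.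
  have mU := measurable_open _ _ oU.
  split => //; last by apply: closed_compact_inner_regular; rewrite closedC.
  have [C cC UC] := open_bigcup_closed _ oU.
  rewrite UC; apply: bigcup_compact_inner_regular => k.
    exact: measurable_closed.
  exact: closed_compact_inner_regular.
split.
- split => //; apply: closed_compact_inner_regular; first exact: closed0.
  by rewrite setC0; exact: closedT.
- move=> B [mB rB rCB]; rewrite setTD; split; rewrite ?setCK //.
  exact: measurableC.
- move=> B HB; have mB n : measurable (B n : set (borel S)) by case: (HB n).
  split; first exact: bigcupT_measurable.
    by apply: bigcup_compact_inner_regular => // n; case: (HB n).
  rewrite setC_bigcup; apply: bigcap_compact_inner_regular => n.
    exact: measurableC.
  by case: (HB n).
Qed.

Lemma borel_ae_sigma_compact (A : set S) : measurable (A : set (borel S)) ->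
  exists K : nat -> set S, [/\ forall j, compact (K j),
    forall j, K j `<=` A & nu (A `\` \bigcup_j K j) = 0].
Proof.
move=> mA.
have /choice[K HK] : forall j : nat, exists K, [/\ compact K, K `<=` A &
    (nu (A `\` K) < (j.+1%:R^-1 : R)%:E)%E].
  by move=> j; apply: borel_compact_inner_regular => //; rewrite invr_gt0.
have mK j : measurable (K j : set (borel S)).
  by have [cK _ _] := HK j; exact: measurable_compact.
exists K; split; [by move=> j; case: (HK j)|by move=> j; case: (HK j)|].
apply/eqP; rewrite eq_le measure_ge0 andbT; apply/lee_addgt0Pr => e e0.
have [j _ /(_ j (leqnn j)) je] := near_infty_natSinv_lt (PosNum e0).
rewrite add0e; have [_ _ nuj] := HK j.
apply: (@le_trans _ _ (nu (A `\` K j))).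
  apply: le_measure; rewrite ?inE.
  - by apply: measurableD => //; exact: bigcupT_measurable.
  - exact: measurableD.
  - by apply: setDS; exact: bigcup_sup.
by apply: ltW; apply: lt_trans nuj _; rewrite lte_fin.
Qed.

End compact_inner_regularity.

(** * The capped infimum: bounds, Lipschitz property and Borel measurability *)

Section capped_inf_convolution.
Context (R : realType) (S : completePseudoMetricType R) (I : countType).
Context (c : S -> S -> R) (K : I -> set S) (a : I -> R) (M : R).
Hypothesis c_ge0 : forall x y, 0 <= c x y.
Hypothesis aM : forall i y, K i y -> a i <= M.

(* The cap [M] makes the set nonempty and the infimum bounded above. *)
Definition capped_values (x : S) : set R :=
  M |` [set t | exists i y, K i y /\ t = c x y - a i].

Definition capped_inf (x : S) : R := inf (capped_values x).

Let capped_values0 x : capped_values x !=set0.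
Proof. by exists M; left. Qed.

Let capped_values_lb x : lbound (capped_values x) (- `|M|).
Proof.
move=> _ [->|[i [y [Kiy ->]]]]; first by rewrite lerNl ler_normr lexx orbT.
apply: (@le_trans _ _ (0 - a i)); last by rewrite lerD2r.
by rewrite sub0r lerN2 (le_trans (aM _ _ Kiy)) // ler_norm.
Qed.

Lemma capped_inf_le x t : capped_values x t -> capped_inf x <= t.
Proof. by move=> xt; apply: ge_inf => //; exists (- `|M|); exact: capped_values_lb. Qed.

Lemma capped_inf_ge x b : lbound (capped_values x) b -> b <= capped_inf x.
Proof. exact: lb_le_inf. Qed.

Lemma capped_inf_bounded x : `|capped_inf x| <= `|M|.
Proof.
rewrite ler_norml capped_inf_ge /=; last exact: capped_values_lb.
by apply: le_trans (ler_norm M); apply: capped_inf_le; left.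
Qed.

Lemma capped_inf_lipschitz : (forall x y z, c x z <= c x y + c y z) ->
  forall x y, capped_inf x - capped_inf y <= c x y.
Proof.
move=> ctri x y; rewrite lerBlDl -lerBlDr; apply: capped_inf_ge.
move=> _ [->|[i [z [Kiz ->]]]]; rewrite lerBlDr.
  (* The cap respects the Lipschitz bound because [c] is nonnegative; the other values use the
     triangle inequality. *)
  by rewrite (@le_trans _ _ M) ?lerDl //; apply: capped_inf_le; left.
rewrite (@le_trans _ _ (c x z - a i)) //.
  by apply: capped_inf_le; right; exists i, z.
by rewrite addrAC lerB // addrC.
Qed.

Lemma capped_inf_lt x t : capped_inf x < t <->
  M < t \/ exists i, exists2 y, K i y & c x y < t + a i.
Proof.
split=> [/(inf_lt (capped_values0 x))[_ [->|[i [y [Kiy ->]]]] lt_t]|].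
- by left.
- by right; exists i, y => //; rewrite -ltrBlDr.
case=> [Mt|[i [y Kiy lt_t]]].
- by apply: le_lt_trans Mt; apply: capped_inf_le; left.
- rewrite -ltrBlDr in lt_t; apply: le_lt_trans lt_t.
  by apply: capped_inf_le; right; exists i, y.
Qed.

Context (cn : nat -> S -> S -> R).
Hypothesis Kcompact : forall i, compact (K i).
Hypothesis cn_lsc : forall n,
  lower_semicontinuous (fun p : S * S => ((cn n p.1 p.2)%:E : \bar R)).
Hypothesis cn_ge : forall n x y, c x y <= cn n x y.
Hypothesis cn_cvg : forall x y, (fun n => cn n x y) @ \oo --> c x y.

(** A decreasing limit of lower semicontinuous functions need not be lower semicontinuous, so closed
    sublevel sets are taken from the [cn n], with slack [1 / (k + 1)] to recover the strict
    inequality. *)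
Lemma measurable_compact_section_lt i t :
  measurable ([set x | exists2 y, K i y & c x y < t] : set (borel S)).
Proof.
rewrite (_ : mkset _ = \bigcup_n \bigcup_k
    [set x | exists2 y, K i y & cn n x y <= t - k.+1%:R^-1]); last first.
  apply/seteqP; split => [x [y Kiy ct]|x [n _ [k _ [y Kiy cnt]]]]; last first.
    exists y => //; apply: le_lt_trans (cn_ge n x y) (le_lt_trans cnt _).
    by rewrite ltrBlDr ltrDl invr_gt0.
  have [n _ /(_ n (leqnn n)) cnt] := cvgr_lt _ (cn_cvg x y) _ ct.
  have tcn : 0 < t - cn n x y by rewrite subr_gt0.
  have [k _ /(_ k (leqnn k)) kt] := near_infty_natSinv_lt (PosNum tcn).
  exists n => //; exists k => //; exists y => //.
  by rewrite lerBrDr addrC -lerBrDr ltW.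
apply: bigcupT_measurable => n; apply: bigcupT_measurable => k.
apply: measurable_closed.
apply: (@closed_compact_projection _ _ _
  [set p | cn n p.1 p.2 <= t - k.+1%:R^-1] (Kcompact i)).
rewrite -openC (_ : ~` _ =
    [set p | ((t - k.+1%:R^-1)%:E < (cn n p.1 p.2)%:E)%E]).
  by have /lower_semicontinuousP := cn_lsc n; exact.
by apply/seteqP; split => p /=; rewrite lte_fin ltNge; move/negP.
Qed.

Lemma capped_inf_measurable :
  measurable_fun [set: borel S] (capped_inf : borel S -> R).
Proof.
move=> mT; apply: (measurability _ (RGenInftyO.measurableE R)) => //.
move=> _ [_ [t ->] <-]; rewrite setTI.
(* The cap contributes everything or nothing; the remaining union is over the countable type [I]. *)
rewrite (_ : _ @^-1` _ = (if M < t then setT else set0) `|`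
    \bigcup_i [set x | exists2 y, K i y & c x y < t + a i]); last first.
  apply/seteqP; split => x /=; rewrite in_itv /=.
    move=> /capped_inf_lt[->|[i Hi]]; first by left.
    by right; exists i.
  move=> xt; apply/capped_inf_lt; move: xt; case: ifP => _ [].
  - by left.
  - by move=> [i _ Hi]; right; exists i.
  - by [].
  - by move=> [i _ Hi]; right; exists i.
apply: measurableU; first by case: ifP.
apply: countable_bigcupT_measurable; first exact: countableP.
by move=> i; exact: measurable_compact_section_lt.
Qed.

End capped_inf_convolution.

(** * Comparison of integrals and integrability of bounded functions *)

Lemma ae_le_integral (d : measure_display) (T : measurableType d) (R : realType)
    (mu : {measure set T -> \bar R}) (f g : T -> \bar R) :
  measurable_fun setT f -> measurable_fun setT g ->
  {ae mu, forall x, (f x <= g x)%E} -> (\int[mu]_x f x <= \int[mu]_x g x)%E.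
Proof.
move=> mf mg fg; rewrite integralE [leRHS]integralE; apply: leeB.
- apply: ae_ge0_le_integral => //; try exact: measurable_funepos.
  apply: filterS fg => x fgx _.
  (* Monotonicity of positive parts, used on the singleton of [x] to obtain it pointwise. *)
  by apply: (@funepos_le _ _ [set x]) => [y|]; rewrite inE // => ->.
- apply: ae_ge0_le_integral => //; try exact: measurable_funeneg.
  apply: filterS fg => x fgx _.
  by apply: (@funeneg_le _ _ [set x]) => [y|]; rewrite inE // => ->.
Qed.

Lemma bB_integrable (R : realType) (T : ptopologicalType)
    (mu : {finite_measure set (borel T) -> \bar R}) (f : T -> R) :
  bB f -> mu.-integrable setT (fun x => (f x)%:E).
Proof.
move=> [mf [M fM]]; apply: measurable_bounded_integrable => //.
  by rewrite ltey_eq fin_num_measure.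
exists M; split; first exact: num_real.
by move=> N MN x _ /=; rewrite (le_trans (fM x)) // ltW.
Qed.

(** * Equality of the two suprema *)

Theorem theorem1p2 (R : realType) (S : completePseudoMetricType R)
  (c : S -> S -> R) (cn : nat -> S -> S -> R) :
  polish_space S ->
  (forall x y, 0 <= c x y) ->
  (forall x, c x x = 0) ->
  (forall x y z, c x z <= c x y + c y z) ->
  (forall n x y, 0 <= cn n x y) ->
  (forall n, lower_semicontinuous (fun p : S * S => ((cn n p.1 p.2)%:E : \bar R))) ->
  (forall n x y, cn n.+1 x y <= cn n x y) ->
  (forall x y, (fun n => cn n x y) @ \oo --> c x y) ->
  forall (mu nu : probability (borel S) R),
  ereal_sup [set r : \bar R | exists phi psi : S -> R,
      [/\ bB phi, bB psi, (forall x y, phi x + psi y <= c x y) &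
          r = (\int[mu]_x (phi x)%:E + \int[nu]_x (psi x)%:E)%E]]
  = ereal_sup [set r : \bar R | exists phi : S -> R,
      [/\ bB phi, (forall x y, phi x - phi y <= c x y) &
          r = (\int[mu]_x (phi x)%:E - \int[nu]_x (phi x)%:E)%E]].
Proof.
move=> polS c_ge0 cxx ctri cn_ge0 cn_lsc cn_dec cn_cvg mu nu.
have intN (f : S -> R) : bB f ->
    (\int[nu]_x (- f x)%:E = - \int[nu]_x (f x)%:E)%E.
  move=> bf; rewrite -integralN //.
  by apply: integrable_add_def => //; exact: bB_integrable.
have bBN (f : S -> R) : bB f -> bB (fun x => - f x).
  move=> [mf [M fM]]; split; first exact: measurableT_comp.
  by exists M => x; rewrite normrN.
apply/eqP; rewrite eq_le; apply/andP; split; last first.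
  (* Easy inequality: [phi] yields the admissible pair [(phi, - phi)]. *)
  apply: le_ereal_sup => _ [phi [bphi phic ->]].
  by exists phi, (fun x => - phi x); split => //; [exact: bBN|rewrite intN].
apply: ge_ereal_sup => _ [phi [psi [bphi bpsi phipsi ->]]].
have [mpsi [M psiM]] := bpsi.
have mpsi_ge q : measurable ([set y | ratr q <= psi y] : set (borel S)).
  rewrite -[X in measurable X]setTI.
  rewrite (_ : mkset _ = psi @^-1` `[ratr q, +oo[%classic).
    by apply: mpsi => //; exact: measurable_itv.
  by apply/seteqP; split => y /=; rewrite in_itv /= andbT.
have /choice[K HK] : forall q : rat, exists K : nat -> set S,
    [/\ forall j, compact (K j), forall j, K j `<=` [set y | ratr q <= psi y] &
      nu ([set y | ratr q <= psi y] `\` \bigcup_j K j) = 0].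
  by move=> q; exact: borel_ae_sigma_compact.
pose KK (i : rat * nat) := K i.1 i.2.
pose a (i : rat * nat) : R := ratr i.1.
have KKpsi i y : KK i y -> a i <= psi y by have [_ + _] := HK i.1; exact.
have KKc i : compact (KK i) by have [cK _ _] := HK i.1; exact: cK.
have aM i y : KK i y -> a i <= M.
  by move=> /KKpsi /le_trans; apply; rewrite (le_trans (ler_norm _)).
have cn_ge n x y : c x y <= cn n x y.
  have cvg_c := cn_cvg x y.
  rewrite -(cvg_lim _ cvg_c) //; apply: (@nonincreasing_cvgn_ge R (fun n => cn n x y)).
    by apply/nonincreasing_seqP => m; exact: cn_dec.
  by apply/cvg_ex; exists (c x y).
pose h := capped_inf R S _ c KK a M.
have bh : bB h.
  split; last by exists `|M| => x; exact: capped_inf_bounded.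
  exact: (capped_inf_measurable _ _ _ _ _ _ _ c_ge0 aM cn).
have phih x : phi x <= h x.
  apply: capped_inf_ge => _ [->|[i [y [/KKpsi apsi ->]]]].
    (* The cap lies above [phi]: on the diagonal, [phi x <= - psi x <= M]. *)
    have := phipsi x x; rewrite cxx -lerBrDr sub0r => /le_trans; apply.
    by rewrite (le_trans _ (psiM x)) // -normrN ler_norm.
  by rewrite lerBrDr (le_trans _ (phipsi x y)) // lerD2l.
have psih : {ae nu, forall x : borel S, psi x <= - h x}.
  have aeF := ae_filter_ringOfSetsType nu.
  have aeK q : {ae nu, forall x, ratr q <= psi x -> exists j, K q j x}.
    have [cK KP nuK] := HK q.
    exists ([set y | ratr q <= psi y] `\` \bigcup_j K q j); split => //.
      apply: measurableD => //; apply: bigcupT_measurable => j.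
      apply: measurable_closed; apply: compact_closed (cK j).
      by case: polS.
    move=> x /= /not_implyP[qx nx]; split => // -[j _ Kj]; apply: nx.
    by exists j.
  (* The null sets for all rationals are merged through their coding by naturals; naturals coding no
     rational impose nothing. *)
  have : {ae nu, forall x, forall n, if unpickle n is Some q then
      ratr q <= psi x -> exists j, K q j x else True}.
    apply: ae_foralln => n; case: (unpickle n) => [q|]; first exact: aeK.
    exact: aeW.
  apply: filterS => x Hx; rewrite lerNr leNgt; apply/negP => hx.
  (* If [- psi x < q < h x], then [x] lies in some [K (- q) j], so [x] itself competes in the
     infimum with value [c x x + q = q], contradicting [q < h x]. *)
  have [q] := rat_in_itvoo hx; rewrite in_itv /= => /andP[h1 h2].
  have := Hx (pickle (- q)); rewrite pickleK rmorphN.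
  rewrite lerNl ltW // => /(_ isT)[j Kj].
  have : h x <= ratr q.
    apply: capped_inf_le => //; right; exists (- q, j), x; split => //.
    by rewrite cxx sub0r /a /= rmorphN opprK.
  by rewrite leNgt h2.
apply: (@le_trans _ _ (\int[mu]_x (h x)%:E - \int[nu]_x (h x)%:E)%E); last first.
  apply: ereal_sup_ubound; exists h; split => //.
  exact: capped_inf_lipschitz.
(* The [mu]-integrals compare by [phi <= h] everywhere, the [nu]-integrals by [psi <= - h] almost
   everywhere. *)
apply: leeD.
  apply: ae_le_integral; [|  |].
  - by apply/measurable_EFinP; case: bphi.
  - by apply/measurable_EFinP; case: bh.
  - by apply: aeW => x; rewrite lee_fin.
rewrite -intN //; apply: ae_le_integral.
- exact/measurable_EFinP.
- by apply/measurable_EFinP; case: (bBN _ bh).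
- by apply: filterS psih => x; rewrite lee_fin.
Qed.
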